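(* Let $n$ be a positive integer, $\mathbf{J}$ a chain, and $\mathbf{L}\le\mathbf{F}_n(\mathbf{J}\overrightarrow{\times}\mathbb{Z})$ a subalgebra. (1) $\mathbf{L}_{\mathrm{loc}}$ is a convex normal subalgebra of $\mathbf{L}$. (2) $(\mathbf{L}_g)_{\mathrm{loc}}$ is a convex normal $\ell$-subgroup of $\mathbf{L}_g$. (3) $\mathbf{L}/\mathbf{L}_{\mathrm{loc}}\cong\mathbf{L}_g/(\mathbf{L}_g)_{\mathrm{loc}}$.
   Context: An $\ell$-pregroup is an algebra $(A,\wedge,\vee,\cdot,1,{}^{\ell},{}^{r})$ such that $(A,\wedge,\vee)$ is a lattice, $(A,\cdot,1)$ is a monoid, multiplication is order-preserving in both arguments, and $a^{\ell}a\le 1\le aa^{\ell}$ and $aa^{r}\le 1\le a^{r}a$ for all $a\in A$. Write $x^{\ell^k}$, $x^{r^k}$ for the $k$-fold application of ${}^\ell$, ${}^r$. An element $a$ is $n$-periodic if $a^{\ell^n}=a^{r^n}$. The group skeleton $\mathbf{L}_g$ of $\mathbf{L}$ is the subalgebra with universe $L_g=\{a\in L:a^\ell=a^r\}$, an $\ell$-group consisting of the invertible elements of $\mathbf{L}$. A subalgebra of $\mathbf{L}$ is normal if for every $a$ in it and every $b\in L$ it contains $b^r a b\wedge 1$ and $b a b^\ell\wedge 1$. For a convex normal subalgebra $\mathbf{H}$ of $\mathbf{L}$, $\mathbf{L}/\mathbf{H}$ is the quotient of $\mathbf{L}$ by the congruence $\{(a,b)\in L^2: ab^\ell\wedge ba^\ell\wedge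 1\in H\}$. For a chain $\mathbf{\Omega}$, $\mathbf{F}(\mathbf{\Omega})$ is the $\ell$-pregroup of all maps $f\colon\Omega\to\Omega$ having residuals and dual residuals of all orders, i.e. such that all iterates of $f^\ell(q)=\min\{p:q\le f(p)\}$ and $f^r(q)=\max\{p:f(p)\le q\}$ exist and $f(p)\le q\Leftrightarrow p\le f^r(q)$ and $f^\ell(p)\le q\Leftrightarrow p\le f(q)$ (and likewise for the iterates), under composition, identity, pointwise order, ${}^\ell$, ${}^r$. $\mathbf{F}_n(\mathbf{\Omega})$ is its subalgebra of $n$-periodic elements. $\mathbf{J}\overrightarrow{\times}\mathbb{Z}$ is $J\times\mathbb{Z}$ with the lexicographic order. It is known that for each $f\in\mathbf{F}_n(\mathbf{J}\overrightarrow{\times}\mathbb{Z})$ there are a unique order-automorphism $\widetilde f$ of $\mathbf{J}$ and a unique family $(\overline f_j)_{j\in J}$ of elements of $\mathbf{F}_n(\mathbb{Z})$ with $f(j,m)=(\widetilde f(j),\overline f_j(m))$ for all $(j,m)\in J\times\mathbb{Z}$. For $\mathbf{M}\le\mathbf{F}_n(\mathbf{J}\overrightarrow{\times}\mathbb{Z})$, the local subalgebra $\mathbf{M}_{\mathrm{loc}}$ of $\mathbf{M}$ has universe $\{f\in M:\widetilde f=\mathrm{id}\}$; thus $(L_g)_{\mathrm{loc}}=L_g\cap L_{\mathrm{loc}}$. *)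

(* Defs.v *)
From HB Require Import structures.
From mathcomp Require Import all_boot all_order ssrint.
From mathcomp Require Import boolp classical_sets.

Set Implicit Arguments.
Unset Strict Implicit.
Unset Printing Implicit Defensive.

Import Order.TTheory.
Local Open Scope order_scope.
Local Open Scope group_scope.
Local Open Scope quotient_scope.

Reserved Notation "x ^l" (at level 1, left associativity, format "x ^l").
Reserved Notation "x ^r" (at level 1, left associativity, format "x ^r").

HB.structure Definition LatticeMonoid d := { A of Order.Lattice d A & Monoid A }.

HB.mixin Record isLPregroup d A of LatticeMonoid d A := {
  linv : A -> A;
  rinv : A -> A;
  lep_mul2l : forall c a b : A, a <= b -> c * a <= c * b;
  lep_mul2r : forall c a b : A, a <= b -> a * c <= b * c;
  mulVlp : forall a : A, linv a * a <= 1;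
  mulpVl : forall a : A, 1 <= a * linv a;
  mulpVr : forall a : A, a * rinv a <= 1;
  mulVrp : forall a : A, 1 <= rinv a * a
}.

#[short(type="lpregroupType")]
HB.structure Definition LPregroup d :=
  { A of LatticeMonoid d A & isLPregroup d A }.

Arguments lep_mul2l {d s} c {a b} _.
Arguments lep_mul2r {d s} c {a b} _.

Notation "x ^l" := (linv x) : group_scope.
Notation "x ^r" := (rinv x) : group_scope.

(* An l-group is an l-pregroup in which ^l and ^r are both the group inverse. *)
HB.structure Definition LPregroupGroup d := { G of LPregroup d G & Group G }.

HB.mixin Record LPregroup_isLGroup d G of LPregroupGroup d G := {
  linvE : forall x : G, x^l = x^-1;
  rinvE : forall x : G, x^r = x^-1
}.

#[short(type="lgroupType")]
HB.structure Definition LGroup d :=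
  { G of LPregroupGroup d G & LPregroup_isLGroup d G }.

Section LPregroupTheory.
Context {d} {A : lpregroupType d}.
Implicit Types a b c : A.

Lemma lep_mul a b a' b' : a <= a' -> b <= b' -> a * b <= a' * b'.
Proof. by move=> /(lep_mul2r b) h /(lep_mul2l a'); exact: le_trans. Qed.

Lemma ler_rinv a b c : (a * b <= c) = (b <= a^r * c).
Proof.
apply/idP/idP => [/(lep_mul2l a^r)|/(lep_mul2l a)]; rewrite mulgA => h.
  by apply: le_trans h; rewrite -{1}[b]mul1g lep_mul2r ?mulVrp.
by apply: le_trans h _; rewrite -{2}[c]mul1g lep_mul2r ?mulpVr.
Qed.

Lemma ler_linv a b c : (b * a <= c) = (b <= c * a^l).
Proof.
apply/idP/idP => [/(lep_mul2r a^l)|/(lep_mul2r a)]; rewrite -mulgA => h.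
  by apply: le_trans h; rewrite -{1}[b]mulg1 lep_mul2l ?mulpVl.
by apply: le_trans h _; rewrite -{2}[c]mulg1 lep_mul2l ?mulVlp.
Qed.

Lemma linv_ler a b c : (a^l * b <= c) = (b <= a * c).
Proof.
apply/idP/idP => [/(lep_mul2l a)|/(lep_mul2l a^l)]; rewrite mulgA => h.
  by apply: le_trans h; rewrite -{1}[b]mul1g lep_mul2r ?mulpVl.
by apply: le_trans h _; rewrite -{2}[c]mul1g lep_mul2r ?mulVlp.
Qed.

Lemma rinv_ler a b c : (b * a^r <= c) = (b <= c * a).
Proof.
apply/idP/idP => [/(lep_mul2r a)|/(lep_mul2r a^r)]; rewrite -mulgA => h.
  by apply: le_trans h; rewrite -{1}[b]mulg1 lep_mul2l ?mulVrp.
by apply: le_trans h _; rewrite -{2}[c]mulg1 lep_mul2l ?mulpVr.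
Qed.

Lemma linvK a : a^l^r = a.
Proof.
have h c b : (b <= a * c) = (b <= a^l^r * c) by rewrite -linv_ler ler_rinv.
by rewrite -[LHS]mulg1 -[RHS]mulg1; apply/le_anti; rewrite h lexx -h lexx.
Qed.

Lemma rinvK a : a^r^l = a.
Proof.
have h c b : (b <= c * a) = (b <= c * a^r^l) by rewrite -rinv_ler ler_linv.
by rewrite -[LHS]mul1g -[RHS]mul1g; apply/le_anti; rewrite h lexx -h lexx.
Qed.

Lemma linvM a b : (a * b)^l = b^l * a^l.
Proof.
have h c e : (c <= e * (a * b)^l) = (c <= e * (b^l * a^l)).
  by rewrite -ler_linv !mulgA !ler_linv.
by rewrite -[LHS]mul1g -[RHS]mul1g; apply/le_anti; rewrite -h lexx h lexx.
Qed.

Lemma rinvM a b : (a * b)^r = b^r * a^r.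
Proof. by rewrite -{1}[a]rinvK -{1}[b]rinvK -linvM linvK. Qed.

Lemma linv1 : (1 : A)^l = 1.
Proof. by apply/le_anti; rewrite -[1^l]mulg1 mulVlp mulg1 -[1^l]mul1g mulpVl. Qed.

Lemma rinv1 : (1 : A)^r = 1.
Proof. by rewrite -{1}linv1 linvK. Qed.

Lemma le_linv a b : (b^l <= a^l) = (a <= b).
Proof.
have E x : x^l = x^l * 1 by rewrite mulg1.
by rewrite E linv_ler -ler_linv mul1g.
Qed.

Lemma le_rinv a b : (b^r <= a^r) = (a <= b).
Proof. by rewrite -le_linv !rinvK. Qed.

Lemma linvI a b : (a `&` b)^l = a^l `|` b^l.
Proof.
apply/le_anti/andP; split; last by rewrite leUx !le_linv leIl leIr.
by rewrite -[leRHS]rinvK le_linv lexI -[X in _ <= X]linvK -[X in _ && (_ <= X)]linvK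
           !le_rinv leUl leUr.
Qed.

Lemma linvU a b : (a `|` b)^l = a^l `&` b^l.
Proof.
apply/le_anti/andP; split; first by rewrite lexI !le_linv leUl leUr.
by rewrite -[leLHS]rinvK le_linv leUx -[X in X <= _]linvK -[X in _ && (X <= _)]linvK
           !le_rinv leIl leIr.
Qed.

Lemma rinvI a b : (a `&` b)^r = a^r `|` b^r.
Proof. by rewrite -{1}[a]rinvK -{1}[b]rinvK -linvU linvK. Qed.

Lemma rinvU a b : (a `|` b)^r = a^r `&` b^r.
Proof. by rewrite -{1}[a]rinvK -{1}[b]rinvK -linvI linvK. Qed.

End LPregroupTheory.

Record is_subalgebra d (A : lpregroupType d) (H : set A) : Prop := {
  subalg1 : H 1;
  subalgM : forall a b, H a -> H b -> H (a * b);
  subalgI : forall a b, H a -> H b -> H (a `&` b);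
  subalgU : forall a b, H a -> H b -> H (a `|` b);
  subalgL : forall a, H a -> H a^l;
  subalgR : forall a, H a -> H a^r
}.

Record subalgebra d (A : lpregroupType d) := Subalgebra {
  subalg_set : set A;
  subalgP : is_subalgebra subalg_set
}.

Definition subalg_sort d (A : lpregroupType d) (B : subalgebra A) : Type :=
  {a : A | a \in subalg_set B}.
Coercion subalg_sort : subalgebra >-> Sortclass.

Section SubalgebraInstances.
Context d (A : lpregroupType d) (B : subalgebra A).
Let S : pred A := fun a => a \in subalg_set B.

Let closedI : {in S &, forall a b, a `&` b \in S}.
Proof.
by move=> a b /set_mem Ba /set_mem Bb; exact: mem_set (subalgI (subalgP B) Ba Bb).
Qed.
Let closedU : {in S &, forall a b, a `|` b \in S}.
Proof.
by move=> a b /set_mem Ba /set_mem Bb; exact: mem_set (subalgU (subalgP B) Ba Bb).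
Qed.
Let closedM : monoid_closed S.
Proof.
split; first exact: mem_set (subalg1 (subalgP B)).
by move=> a b /set_mem Ba /set_mem Bb; exact: mem_set (subalgM (subalgP B) Ba Bb).
Qed.

HB.instance Definition _ := SubChoice.copy (subalg_sort B) {a : A | S a}.
HB.instance Definition _ :=
  Order.SubChoice_isSubLattice.Build d A S d (subalg_sort B) closedI closedU.
HB.instance Definition _ :=
  SubChoice_isSubMonoid.Build A S (subalg_sort B) closedM.

Let inB (a : A) (Ba : subalg_set B a) : subalg_sort B := exist _ a (mem_set Ba).
Let linvB (x : B) := inB (subalgL (subalgP B) (set_mem (valP x))).
Let rinvB (x : B) := inB (subalgR (subalgP B) (set_mem (valP x))).

Let leB (x y : B) : (x <= y) = (val x <= val y). Proof. by []. Qed.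
Let valMB (x y : B) : val (x * y) = val x * val y. Proof. by []. Qed.

Let lep_mul2lB (z x y : B) : x <= y -> z * x <= z * y.
Proof. by rewrite !leB !valMB; exact: lep_mul2l. Qed.
Let lep_mul2rB (z x y : B) : x <= y -> x * z <= y * z.
Proof. by rewrite !leB !valMB; exact: lep_mul2r. Qed.
Let mulVlpB (x : B) : linvB x * x <= 1. Proof. exact: mulVlp. Qed.
Let mulpVlB (x : B) : 1 <= x * linvB x. Proof. exact: mulpVl. Qed.
Let mulpVrB (x : B) : x * rinvB x <= 1. Proof. exact: mulpVr. Qed.
Let mulVrpB (x : B) : 1 <= rinvB x * x. Proof. exact: mulVrp. Qed.

HB.instance Definition _ := isLPregroup.Build d (subalg_sort B)
  lep_mul2lB lep_mul2rB mulVlpB mulpVlB mulpVrB mulVrpB.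

End SubalgebraInstances.

Definition nperiodic d (A : lpregroupType d) n : set A :=
  [set a | iter n linv a = iter n rinv a]%classic.

Section Periodic.
Context d (A : lpregroupType d).
Implicit Types a b : A.

Let iterlM n a b : iter n linv (a * b) =
  if odd n then iter n linv b * iter n linv a else iter n linv a * iter n linv b.
Proof. by elim: n => //= n ->; case: odd; rewrite /= linvM. Qed.
Let iterrM n a b : iter n rinv (a * b) =
  if odd n then iter n rinv b * iter n rinv a else iter n rinv a * iter n rinv b.
Proof. by elim: n => //= n ->; case: odd; rewrite /= rinvM. Qed.
Let iterlI n a b : iter n linv (a `&` b) =
  if odd n then iter n linv a `|` iter n linv b else iter n linv a `&` iter n linv b.
Proof. by elim: n => //= n ->; case: odd; rewrite /= (linvI, linvU). Qed.
Let iterrI n a b : iter n rinv (a `&` b) =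
  if odd n then iter n rinv a `|` iter n rinv b else iter n rinv a `&` iter n rinv b.
Proof. by elim: n => //= n ->; case: odd; rewrite /= (rinvI, rinvU). Qed.
Let iterlU n a b : iter n linv (a `|` b) =
  if odd n then iter n linv a `&` iter n linv b else iter n linv a `|` iter n linv b.
Proof. by elim: n => //= n ->; case: odd; rewrite /= (linvI, linvU). Qed.
Let iterrU n a b : iter n rinv (a `|` b) =
  if odd n then iter n rinv a `&` iter n rinv b else iter n rinv a `|` iter n rinv b.
Proof. by elim: n => //= n ->; case: odd; rewrite /= (rinvI, rinvU). Qed.

Lemma nperiodic_subalgebra n : is_subalgebra (@nperiodic d A n).
Proof.
rewrite /nperiodic; split=> /= [|a b ha hb|a b ha hb|a b ha hb|a ha|a ha].
- by elim: n => //= n; rewrite -!iterS !iterSr linv1 rinv1.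
- by rewrite iterlM iterrM ha hb.
- by rewrite iterlI iterrI ha hb.
- by rewrite iterlU iterrU ha hb.
- rewrite -iterSr iterS ha; elim: n {ha} => //= n <-.
  by rewrite linvK rinvK.
- rewrite -[RHS]iterSr iterS -ha; elim: n {ha} => //= n ->.
  by rewrite linvK rinvK.
Qed.

End Periodic.

Definition nperiodic_subalg d (A : lpregroupType d) n : subalgebra A :=
  Subalgebra (@nperiodic_subalgebra d A n).

Lemma skeleton_subalgebra d (A : lpregroupType d) :
  is_subalgebra [set a : A | a^l = a^r]%classic.
Proof. exact: (@nperiodic_subalgebra d A 1). Qed.

Definition skeleton d (A : lpregroupType d) : subalgebra A :=
  Subalgebra (@skeleton_subalgebra d A).

Section SkeletonLGroup.
Context d (A : lpregroupType d).

Let skeletonE (x : skeleton A) : x^l = x^r.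
Proof. by apply: val_inj; exact: (set_mem (valP x)). Qed.

HB.instance Definition _ := hasInv.Build (skeleton A) (@linv d (skeleton A)).

Let mulVs : left_inverse 1 inv (@mul (skeleton A)).
Proof.
by move=> x; apply/le_anti; rewrite mulVlp [inv x]skeletonE mulVrp.
Qed.
Let mulsV : right_inverse 1 inv (@mul (skeleton A)).
Proof.
by move=> x; apply/le_anti; rewrite mulpVl [inv x]skeletonE mulpVr.
Qed.
HB.instance Definition _ := Monoid_isGroup.Build (skeleton A) mulVs mulsV.


Let linvEs (x : skeleton A) : x^l = x^-1. Proof. by []. Qed.
Let rinvEs (x : skeleton A) : x^r = x^-1. Proof. by rewrite -skeletonE. Qed.
HB.instance Definition _ :=
  LPregroup_isLGroup.Build d (skeleton A) linvEs rinvEs.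

End SkeletonLGroup.

Definition convex d (A : porderType d) (H : set A) : Prop :=
  forall a b c, H a -> H c -> a <= b -> b <= c -> H b.

Definition normal d (A : lpregroupType d) (H : set A) : Prop :=
  forall a b, H a -> H ((b^r * a * b) `&` 1) /\ H ((b * a * b^l) `&` 1).

Record convex_normal_subalgebra d (A : lpregroupType d) (H : set A) : Prop := {
  cns_subalgebra : is_subalgebra H;
  cns_convex : convex H;
  cns_normal : normal H
}.

(* Normality is meant in the sense of group theory; it implies the normality of
   l-pregroups, see [convex_normal_lsubgroupW]. *)
Record convex_normal_lsubgroup d (G : lgroupType d) (H : set G) : Prop := {
  cnl_1 : H 1;
  cnl_M : forall a b, H a -> H b -> H (a * b);
  cnl_V : forall a, H a -> H a^-1;
  cnl_I : forall a b, H a -> H b -> H (a `&` b);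
  cnl_U : forall a b, H a -> H b -> H (a `|` b);
  cnl_convex : convex H;
  cnl_normal : forall a b, H a -> H (a ^ b)
}.

Lemma convex_normal_lsubgroupW d (G : lgroupType d) (H : set G) :
  convex_normal_lsubgroup H -> convex_normal_subalgebra H.
Proof.
move=> cn; split=> [||a b Ha]; [split|exact: cnl_convex cn|].
- exact: cnl_1 cn.
- exact: cnl_M cn.
- exact: cnl_I cn.
- exact: cnl_U cn.
- by move=> a Ha; rewrite linvE; exact: cnl_V cn _ Ha.
- by move=> a Ha; rewrite rinvE; exact: cnl_V cn _ Ha.
- have H1 := cnl_1 cn; split; apply: (cnl_I cn) => //.
    by rewrite rinvE -mulgA; exact: cnl_normal cn _ _ Ha.
  by rewrite linvE -{1}[b]invgK -mulgA; exact: cnl_normal cn _ _ Ha.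
Qed.

Definition quo_rel d (A : lpregroupType d) (H : set A) : rel A :=
  fun a b => `[< H ((a * b^l) `&` (b * a^l) `&` 1) >].

Section Quotient.
Context d (A : lpregroupType d) (H : set A) (cn : convex_normal_subalgebra H).
Implicit Types a b c : A.
Let sH := cns_subalgebra cn.

(* a is below b in the quotient *)
Let quo_le a b := exists2 h, H h & h <= 1 /\ h * a <= b.

Let quo_relP a b : reflect (quo_le a b /\ quo_le b a) (quo_rel H a b).
Proof.
apply: (iffP (asboolP _)) => [Hab|[[h Hh [h1 hab]] [k Hk [k1 kba]]]].
  split; exists ((a * b^l) `&` (b * a^l) `&` 1) => //; split; rewrite ?leIr //.
    by rewrite ler_linv leIxl // leIr.
  by rewrite ler_linv leIxl // leIl.
apply: (cns_convex cn (subalgI sH Hh Hk) (subalg1 sH)); last exact: leIr.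
rewrite !lexI -!ler_linv leIxl // andbT.
by rewrite (le_trans _ hab) ?(le_trans _ kba) // lep_mul2r // (leIl, leIr).
Qed.

(* left multipliers can be traded for right ones, and conversely *)
Let mulHr h a : H h -> h <= 1 -> exists2 k, H k & k <= 1 /\ a * k <= h * a.
Proof.
move=> Hh h1; exists ((a^r * h * a) `&` 1); first by have [] := cns_normal cn a Hh.
by split; [exact: leIr|rewrite ler_rinv leIxl // mulgA].
Qed.
Let mulHl h a : H h -> h <= 1 -> exists2 k, H k & k <= 1 /\ k * a <= a * h.
Proof.
move=> Hh h1; exists ((a * h * a^l) `&` 1); first by have [] := cns_normal cn a Hh.
by split; [exact: leIr|rewrite ler_linv leIxl].
Qed.

Let quo_leW a b : a <= b -> quo_le a b.
Proof. by move=> ab; exists 1; rewrite ?mul1g //; exact: subalg1 sH. Qed.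

Let quo_le_trans a b c : quo_le a b -> quo_le b c -> quo_le a c.
Proof.
move=> [h Hh [h1 hab]] [k Hk [k1 kbc]]; exists (k * h); first exact: (subalgM sH).
split; first by rewrite -[X in _ <= X]mulg1 lep_mul.
by rewrite -mulgA (le_trans _ kbc) // lep_mul2l.
Qed.

Let quo_leI a b c : quo_le a b -> quo_le a c -> quo_le a (b `&` c).
Proof.
move=> [h Hh [h1 hab]] [k Hk [k1 kac]]; exists (h `&` k); first exact: (subalgI sH).
rewrite lexI leIxl //; split=> //; apply/andP; split.
  by rewrite (le_trans _ hab) // lep_mul2r // leIl.
by rewrite (le_trans _ kac) // lep_mul2r // leIr.
Qed.

Let quo_leU a b c : quo_le a c -> quo_le b c -> quo_le (a `|` b) c.
Proof.
move=> [h Hh [h1 hac]] [k Hk [k1 kbc]]; exists (h `&` k); first exact: (subalgI sH).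
rewrite ler_rinv leUx -!ler_rinv leIxl //; split=> //; apply/andP; split.
  by rewrite (le_trans _ hac) // lep_mul2r // leIl.
by rewrite (le_trans _ kbc) // lep_mul2r // leIr.
Qed.

Let quo_leM a b a' b' : quo_le a a' -> quo_le b b' -> quo_le (a * b) (a' * b').
Proof.
move=> [h Hh [h1 ha]] [k Hk [k1 kb]].
have [m Hm [m1 ma]] := mulHl a Hk k1.
apply: (@quo_le_trans _ (a * b')).
  exists m => //; split => //; apply: (le_trans _ (lep_mul2l a kb)).
  by rewrite !mulgA lep_mul2r.
by exists h => //; split => //; rewrite mulgA lep_mul2r.
Qed.

Let quo_le_linv a b : quo_le a b -> quo_le b^l a^l.
Proof.
move=> [h Hh [h1 hab]]; have [k Hk [k1 kb]] := mulHl b^l Hh h1.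
exists k => //; split => //; apply: (le_trans kb).
rewrite -le_linv linvM in hab; apply: le_trans (lep_mul2r h hab) _.
by rewrite -mulgA -[X in _ <= X]mulg1 lep_mul2l ?mulVlp.
Qed.

Let quo_le_rinv a b : quo_le a b -> quo_le b^r a^r.
Proof.
move=> [h Hh [h1 hab]]; have [k Hk [k1 ka]] := mulHr a Hh h1.
exists k => //; split => //.
have := le_trans ka hab; rewrite -le_rinv rinvM => /(lep_mul2l k) kb.
by apply: le_trans kb _; rewrite mulgA -[X in _ <= X]mul1g lep_mul2r ?mulpVr.
Qed.

Lemma quo_rel_refl : reflexive (quo_rel H).
Proof. by move=> a; apply/quo_relP; split; exact: quo_leW. Qed.

Lemma quo_rel_sym : symmetric (quo_rel H).
Proof. by move=> a b; apply/quo_relP/quo_relP => -[]. Qed.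

Lemma quo_rel_trans : transitive (quo_rel H).
Proof.
move=> b a c /quo_relP[ab ba] /quo_relP[bc cb].
by apply/quo_relP; split; [exact: quo_le_trans bc|exact: quo_le_trans ba].
Qed.

Lemma quo_relM a b a' b' :
  quo_rel H a a' -> quo_rel H b b' -> quo_rel H (a * b) (a' * b').
Proof.
move=> /quo_relP[? ?] /quo_relP[? ?]; apply/quo_relP.
by split; exact: quo_leM.
Qed.

Lemma quo_relI a b a' b' :
  quo_rel H a a' -> quo_rel H b b' -> quo_rel H (a `&` b) (a' `&` b').
Proof.
move=> /quo_relP[? ?] /quo_relP[? ?]; apply/quo_relP; split;
  by apply: quo_leI; [apply: (quo_le_trans (quo_leW (leIl _ _)))
                     |apply: (quo_le_trans (quo_leW (leIr _ _)))].
Qed.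

Lemma quo_relU a b a' b' :
  quo_rel H a a' -> quo_rel H b b' -> quo_rel H (a `|` b) (a' `|` b').
Proof.
move=> /quo_relP[? ?] /quo_relP[? ?]; apply/quo_relP; split;
  by apply: quo_leU; [apply: (quo_le_trans _ (quo_leW (leUl _ _)))
                     |apply: (quo_le_trans _ (quo_leW (leUr _ _)))].
Qed.

Lemma quo_rel_linv a b : quo_rel H a b -> quo_rel H a^l b^l.
Proof.
by move=> /quo_relP[? ?]; apply/quo_relP; split; exact: quo_le_linv.
Qed.

Lemma quo_rel_rinv a b : quo_rel H a b -> quo_rel H a^r b^r.
Proof.
by move=> /quo_relP[? ?]; apply/quo_relP; split; exact: quo_le_rinv.
Qed.

Definition quo_equiv := EquivRel (quo_rel H) quo_rel_refl quo_rel_sym quo_rel_trans.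

Definition quo := {eq_quot quo_equiv}.
HB.instance Definition _ := Choice.on quo.
HB.instance Definition _ := EqQuotient.on quo.

Definition quo_mul := lift_op2 quo mul.
Definition quo_meet := lift_op2 quo Order.meet.
Definition quo_join := lift_op2 quo Order.join.
Definition quo_linv := lift_op1 quo linv.
Definition quo_rinv := lift_op1 quo rinv.

Lemma quoP a b : reflect (\pi_quo a = \pi_quo b) (quo_rel H a b).
Proof. exact: (@eqquotP _ quo_equiv quo). Qed.

Let reprE a : quo_rel H a (repr (\pi_quo a)).
Proof. by apply/quoP; rewrite reprK. Qed.

Lemma pi_quo_mul : {morph \pi_quo : a b / a * b >-> quo_mul a b}.
Proof. by move=> a b; unlock quo_mul; apply/quoP; exact: quo_relM. Qed.
Lemma pi_quo_meet : {morph \pi_quo : a b / a `&` b >-> quo_meet a b}.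
Proof. by move=> a b; unlock quo_meet; apply/quoP; exact: quo_relI. Qed.
Lemma pi_quo_join : {morph \pi_quo : a b / a `|` b >-> quo_join a b}.
Proof. by move=> a b; unlock quo_join; apply/quoP; exact: quo_relU. Qed.
Lemma pi_quo_linv : {morph \pi_quo : a / a^l >-> quo_linv a}.
Proof. by move=> a; unlock quo_linv; apply/quoP; exact: quo_rel_linv. Qed.
Lemma pi_quo_rinv : {morph \pi_quo : a / a^r >-> quo_rinv a}.
Proof. by move=> a; unlock quo_rinv; apply/quoP; exact: quo_rel_rinv. Qed.

Let piE := (=^~ pi_quo_mul, =^~ pi_quo_meet, =^~ pi_quo_join).

Let quo_meetC : commutative quo_meet.
Proof. by elim/quotW => a; elim/quotW => b; rewrite !piE meetC. Qed.
Let quo_joinC : commutative quo_join.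
Proof. by elim/quotW => a; elim/quotW => b; rewrite !piE joinC. Qed.
Let quo_meetA : associative quo_meet.
Proof.
by elim/quotW => a; elim/quotW => b; elim/quotW => c; rewrite !piE meetA.
Qed.
Let quo_joinA : associative quo_join.
Proof.
by elim/quotW => a; elim/quotW => b; elim/quotW => c; rewrite !piE joinA.
Qed.
Let quo_joinKI y x : quo_meet x (quo_join x y) = x.
Proof. by elim/quotW: x => a; elim/quotW: y => b; rewrite !piE joinKI. Qed.
Let quo_meetKU y x : quo_join x (quo_meet x y) = x.
Proof. by elim/quotW: x => a; elim/quotW: y => b; rewrite !piE meetKU. Qed.
Let quo_mulA : associative quo_mul.
Proof.
by elim/quotW => a; elim/quotW => b; elim/quotW => c; rewrite !piE mulgA.
Qed.
Let quo_mul1 : left_id (\pi_quo 1) quo_mul.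
Proof. by elim/quotW => a; rewrite !piE mul1g. Qed.
Let quo_mulg1 : right_id (\pi_quo 1) quo_mul.
Proof. by elim/quotW => a; rewrite !piE mulg1. Qed.

Definition quo_ord : rel quo := fun x y => quo_meet x y == x.

Let quo_ord_refl : reflexive quo_ord.
Proof. by elim/quotW => a; rewrite /quo_ord !piE meetxx. Qed.
Let quo_ord_anti : antisymmetric quo_ord.
Proof. by move=> x y /andP[/eqP + /eqP]; rewrite quo_meetC => -> ->. Qed.
Let quo_ord_trans : transitive quo_ord.
Proof.
move=> y x z /eqP xy /eqP yz.
by rewrite /quo_ord -xy -quo_meetA yz.
Qed.

HB.instance Definition _ :=
  Order.Le_isPOrder.Build d quo quo_ord_refl quo_ord_anti quo_ord_trans.
HB.instance Definition _ := Order.POrder_isLattice.Build d quo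
  quo_meetC quo_joinC quo_meetA quo_joinA quo_joinKI quo_meetKU
  (fun _ _ => erefl).
HB.instance Definition _ := isMonoid.Build quo quo_mulA quo_mul1 quo_mulg1.

Let pi_le a b : a <= b -> \pi_quo a <= \pi_quo b.
Proof. by move=> /meet_l ab; apply/eqP; rewrite /= -[LHS]pi_quo_meet ab. Qed.
Let le_pi (x y : quo) : x <= y ->
  exists a b, [/\ x = \pi_quo a, y = \pi_quo b & a <= b].
Proof.
elim/quotW: x => a; elim/quotW: y => b /eqP ab.
exists (a `&` b), b; split=> //; last exact: leIr.
by rewrite pi_quo_meet.
Qed.
Let quo_lep_mul2l (z x y : quo) : x <= y -> z * x <= z * y.
Proof.
move=> /le_pi[a [b [-> -> ab]]]; elim/quotW: z => c.
by rewrite -[X in X <= _]pi_quo_mul -[X in _ <= X]pi_quo_mul pi_le ?lep_mul2l.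
Qed.
Let quo_lep_mul2r (z x y : quo) : x <= y -> x * z <= y * z.
Proof.
move=> /le_pi[a [b [-> -> ab]]]; elim/quotW: z => c.
by rewrite -[X in X <= _]pi_quo_mul -[X in _ <= X]pi_quo_mul pi_le ?lep_mul2r.
Qed.
Let quo_mulVlp (x : quo) : quo_linv x * x <= 1.
Proof.
elim/quotW: x => a; rewrite -pi_quo_linv -[X in X <= _]pi_quo_mul.
by apply: pi_le; exact: mulVlp.
Qed.
Let quo_mulpVl (x : quo) : 1 <= x * quo_linv x.
Proof.
elim/quotW: x => a; rewrite -pi_quo_linv -[X in _ <= X]pi_quo_mul.
by apply: pi_le; exact: mulpVl.
Qed.
Let quo_mulpVr (x : quo) : x * quo_rinv x <= 1.
Proof.
elim/quotW: x => a; rewrite -pi_quo_rinv -[X in X <= _]pi_quo_mul.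
by apply: pi_le; exact: mulpVr.
Qed.
Let quo_mulVrp (x : quo) : 1 <= quo_rinv x * x.
Proof.
elim/quotW: x => a; rewrite -pi_quo_rinv -[X in _ <= X]pi_quo_mul.
by apply: pi_le; exact: mulVrp.
Qed.

HB.instance Definition _ := isLPregroup.Build d quo quo_lep_mul2l quo_lep_mul2r
  quo_mulVlp quo_mulpVl quo_mulpVr quo_mulVrp.

End Quotient.

Record isomorphism d d' (A : lpregroupType d) (B : lpregroupType d')
    (f : A -> B) : Prop := {
  iso_bij : bijective f;
  iso_meet : {morph f : a b / a `&` b};
  iso_join : {morph f : a b / a `|` b};
  iso_mul : {morph f : a b / a * b};
  iso_one : f 1 = 1;
  iso_linv : {morph f : a / a^l};
  iso_rinv : {morph f : a / a^r}
}.

Definition isomorphic d d' (A : lpregroupType d) (B : lpregroupType d') : Prop :=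
  exists f : A -> B, isomorphism f.

Section ResiduatedMaps.
Context d (T : orderType d).
Implicit Types f g h : T -> T.

(* [lres f] is f^l and [rres f] is f^r: [f^l q = min {p | q <= f p}] and [f^r q = max {p | f p <= q}]; the default
   value [q], used when there is no such min or max, is irrelevant for maps
   satisfying [all_residuals] *)
Definition lres f (q : T) : T :=
  xget q [set p | q <= f p /\ forall p', q <= f p' -> p <= p']%classic.
Definition rres f (q : T) : T :=
  xget q [set p | f p <= q /\ forall p', f p' <= q -> p' <= p]%classic.

Definition adjoint f g := forall p q, (f p <= q) = (p <= g q).

Definition all_residuals f := forall k,
  adjoint (iter k rres f) (iter k.+1 rres f) /\
  adjoint (iter k.+1 lres f) (iter k lres f).

Lemma adjoint_rres f g : adjoint f g -> rres f = g.
Proof.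
move=> fg; apply/funext => q; apply: xget_unique => [|p [fp pmax]].
  by split=> [|p]; rewrite fg.
by apply/le_anti; rewrite -fg fp pmax // fg.
Qed.

Lemma adjoint_lres f g : adjoint f g -> lres g = f.
Proof.
move=> fg; apply/funext => q; apply: xget_unique => [|p [gp pmin]].
  by split=> [|p]; rewrite -fg.
by apply/le_anti; rewrite fg gp andbT pmin // -fg.
Qed.

Lemma all_residuals_coind (K : (T -> T) -> Prop) :
    (forall f, K f -> exists g h, [/\ K g, K h, adjoint f g & adjoint h f]) ->
  forall f, K f -> all_residuals f.
Proof.
move=> Kres.
have rK f : K f -> K (rres f) /\ adjoint f (rres f).
  by move=> /Kres[g [h [Kg _ /[dup] /adjoint_rres -> fg _]]].
have lK f : K f -> K (lres f) /\ adjoint (lres f) f.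
  by move=> /Kres[g [h [_ Kh _ /[dup] /adjoint_lres -> fh]]].
have irK k f : K f -> K (iter k rres f).
  by move=> Kf; elim: k => //= k /rK[].
have ilK k f : K f -> K (iter k lres f).
  by move=> Kf; elim: k => //= k /lK[].
by move=> f Kf k; split; [have /rK[] := irK k f Kf|have /lK[] := ilK k f Kf].
Qed.

Lemma all_residuals_rl f : all_residuals f ->
  [/\ adjoint f (rres f), adjoint (lres f) f, lres (rres f) = f & rres (lres f) = f].
Proof.
by move=> /(_ 0)[/= fr lf]; rewrite (adjoint_lres fr) (adjoint_rres lf).
Qed.

Lemma all_residuals_rres f : all_residuals f -> all_residuals (rres f).
Proof.
move=> /[dup] /all_residuals_rl[_ _ lr _] fP [|k].
  by rewrite /= lr; split; [have [] := fP 1%N|have [] := fP 0%N].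
rewrite -!iterSr ![iter _ lres (rres f)]iterSr lr.
by split; [have [] := fP k.+2|have [] := fP k].
Qed.

Lemma all_residuals_lres f : all_residuals f -> all_residuals (lres f).
Proof.
move=> /[dup] /all_residuals_rl[_ _ _ rl] fP [|k].
  by rewrite /= rl; split; [have [] := fP 0%N|have [] := fP 1%N].
rewrite -!iterSr ![iter _ rres (lres f)]iterSr rl.
by split; [have [] := fP k|have [] := fP k.+2].
Qed.

Lemma adjoint_comp f f' g g' :
  adjoint f f' -> adjoint g g' -> adjoint (f \o g) (g' \o f').
Proof. by move=> ff gg p q /=; rewrite ff gg. Qed.

Lemma adjoint_meet f f' g g' :
  adjoint f f' -> adjoint g g' -> adjoint (f `|` g) (f' `&` g').
Proof. by move=> ff gg p q; rewrite joinfE meetfE leUx lexI ff gg. Qed.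

Lemma adjoint_join f f' g g' :
  adjoint f f' -> adjoint g g' -> adjoint (f `&` g) (f' `|` g').
Proof.
move=> ff gg p q; rewrite joinfE meetfE.
by rewrite leIx lexU ff gg.
Qed.

Lemma all_residuals_id : all_residuals (@id T).
Proof.
by apply: (@all_residuals_coind (eq id)) => // f <-; exists id, id.
Qed.

Lemma all_residuals_comp f g :
  all_residuals f -> all_residuals g -> all_residuals (f \o g).
Proof.
move=> fP gP; apply: (@all_residuals_coind [set h | exists f g,
  [/\ all_residuals f, all_residuals g & h = f \o g]]%classic); last by exists f, g.
move=> _ [{fP}f [{gP}g [fP gP ->]]].
have [fr lf _ _] := all_residuals_rl fP.
have [gr lg _ _] := all_residuals_rl gP.
exists (rres g \o rres f), (lres g \o lres f); split; last 2 first.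
- exact: adjoint_comp.
- exact: adjoint_comp.
- by exists (rres g), (rres f); split => //; exact: all_residuals_rres.
- by exists (lres g), (lres f); split => //; exact: all_residuals_lres.
Qed.

Let all_residualsIU h (f g : T -> T) :
  all_residuals f -> all_residuals g -> h = f `&` g \/ h = f `|` g -> all_residuals h.
Proof.
move=> fP gP hfg; pose K (h : T -> T) := exists f g : T -> T,
  [/\ all_residuals f, all_residuals g & h = f `&` g \/ h = f `|` g].
apply: (@all_residuals_coind K); last by exists f, g.
move=> {hfg} {}h [{fP}f [{gP}g [fP gP hfg]]].
have [fr lf _ _] := all_residuals_rl fP.
have [gr lg _ _] := all_residuals_rl gP.
have [fr' fl'] := (all_residuals_rres fP, all_residuals_lres fP).
have [gr' gl'] := (all_residuals_rres gP, all_residuals_lres gP).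
case: hfg => ->.
- exists (rres f `|` rres g), (lres f `|` lres g); split.
  + by exists (rres f), (rres g); split => //; right.
  + by exists (lres f), (lres g); split => //; right.
  + exact: adjoint_join.
  + exact: adjoint_meet.
- exists (rres f `&` rres g), (lres f `&` lres g); split.
  + by exists (rres f), (rres g); split => //; left.
  + by exists (lres f), (lres g); split => //; left.
  + exact: adjoint_meet.
  + exact: adjoint_join.
Qed.

Lemma all_residualsI f g :
  all_residuals f -> all_residuals g -> all_residuals (f `&` g).
Proof. by move=> fP gP; apply: all_residualsIU fP gP _; left. Qed.

Lemma all_residualsU f g :
  all_residuals f -> all_residuals g -> all_residuals (f `|` g).
Proof. by move=> fP gP; apply: all_residualsIU fP gP _; right. Qed.

(* F(T): the order is pointwise and the product is composition *)
Definition resmap : Type := {f : T -> T | f \in [set f | all_residuals f]%classic}.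

Let S : pred (T -> T) := fun f => f \in [set f | all_residuals f]%classic.

Let closedI : {in S &, forall f g, f `&` g \in S}.
Proof.
by move=> f g /set_mem fP /set_mem gP; exact: mem_set (all_residualsI fP gP).
Qed.
Let closedU : {in S &, forall f g, f `|` g \in S}.
Proof.
by move=> f g /set_mem fP /set_mem gP; exact: mem_set (all_residualsU fP gP).
Qed.

HB.instance Definition _ := SubChoice.copy resmap {f : T -> T | S f}.
HB.instance Definition _ := Order.SubChoice_isSubLattice.Build
  _ (T -> T) S d resmap closedI closedU.

Let resmapP (f : resmap) : all_residuals (val f) := set_mem (valP f).
Let Resmap f (fP : all_residuals f) : resmap := exist _ f (mem_set fP).

Definition resmap_comp (f g : resmap) : resmap :=
  Resmap (all_residuals_comp (resmapP f) (resmapP g)).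
Definition resmap_id : resmap := Resmap all_residuals_id.
Definition resmap_lres (f : resmap) : resmap :=
  Resmap (all_residuals_lres (resmapP f)).
Definition resmap_rres (f : resmap) : resmap :=
  Resmap (all_residuals_rres (resmapP f)).

Let resmap_compA : associative resmap_comp.
Proof. by move=> f g h; apply: val_inj. Qed.
Let resmap_id_comp : left_id resmap_id resmap_comp.
Proof. by move=> f; apply: val_inj. Qed.
Let resmap_comp_id : right_id resmap_id resmap_comp.
Proof. by move=> f; apply: val_inj. Qed.
HB.instance Definition _ :=
  isMonoid.Build resmap resmap_compA resmap_id_comp resmap_comp_id.

Let resmap_leP (f g : resmap) : reflect (forall p, val f p <= val g p) (f <= g).
Proof. exact: lefP. Qed.

Let resmap_homo (f : resmap) p q : p <= q -> val f p <= val f q.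
Proof.
have [fr _ _ _] := all_residuals_rl (resmapP f).
by move=> pq; rewrite fr (le_trans pq) // -fr.
Qed.
Let resmap_lep_mul2l (h f g : resmap) : f <= g -> h * f <= h * g.
Proof. by move=> /resmap_leP fg; apply/resmap_leP => p; exact: (resmap_homo h (fg p)). Qed.
Let resmap_lep_mul2r (h f g : resmap) : f <= g -> f * h <= g * h.
Proof. by move=> /resmap_leP fg; apply/resmap_leP => p; exact: fg. Qed.
Let resmap_mulVlp (f : resmap) : resmap_lres f * f <= 1.
Proof.
have [_ lf _ _] := all_residuals_rl (resmapP f).
by apply/resmap_leP => p; rewrite lf.
Qed.
Let resmap_mulpVl (f : resmap) : 1 <= f * resmap_lres f.
Proof.
have [_ lf _ _] := all_residuals_rl (resmapP f).
by apply/resmap_leP => p; have: p <= val f (lres (val f) p) by rewrite -lf.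
Qed.
Let resmap_mulpVr (f : resmap) : f * resmap_rres f <= 1.
Proof.
have [fr _ _ _] := all_residuals_rl (resmapP f).
by apply/resmap_leP => p; rewrite fr.
Qed.
Let resmap_mulVrp (f : resmap) : 1 <= resmap_rres f * f.
Proof.
have [fr _ _ _] := all_residuals_rl (resmapP f).
by apply/resmap_leP => p; have: p <= rres (val f) (val f p) by rewrite -fr.
Qed.

HB.instance Definition _ := isLPregroup.Build d resmap
  resmap_lep_mul2l resmap_lep_mul2r
  resmap_mulVlp resmap_mulpVl resmap_mulpVr resmap_mulVrp.

End ResiduatedMaps.

(* F_n(T) *)
Definition periodic_resmap n d (T : orderType d) : subalgebra (resmap T) :=
  nperiodic_subalg (resmap T) n.

Definition fun_of_periodic n d (T : orderType d) (f : periodic_resmap n T) : T -> T :=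
  val (val f).

Definition order_automorphism d (J : porderType d) (t : J -> J) : Prop :=
  bijective t /\ {mono t : i j / i <= j}.

Section Local.
Context (n : nat) d (J : orderType d).
Local Notation Fn := (periodic_resmap n (J *l int)).

(* [t] is the order-automorphism of [J] induced by [f]; it is unique when it
   exists, see [is_tilde_unique], and exists whenever [0 < n]. *)
Definition is_tilde (f : Fn) (t : J -> J) : Prop :=
  order_automorphism t /\
  exists fbar : J -> periodic_resmap n int,
    forall j m, fun_of_periodic f (j, m) = (t j, fun_of_periodic (fbar j) m).

Lemma is_tilde_unique f t t' : is_tilde f t -> is_tilde f t' -> t = t'.
Proof.
move=> [_ [fbar ft]] [_ [fbar' ft']]; apply/funext => j.
by have := ft j 0; rewrite ft' => -[].
Qed.

Definition local (M : subalgebra Fn) : set M := [set f : M | is_tilde (val f) id]%classic.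

(* (L_g)_loc is the intersection of L_g and L_loc, taken here as a subset of L_g. *)
Definition local_skeleton (L : subalgebra Fn) : set (skeleton L) :=
  [set g : skeleton L | local (val g)]%classic.

End Local.
Arguments local {n d J} M _.
Arguments local_skeleton {n d J} L _.

(* Main.v *)
Require Import Defs.
From mathcomp Require Import all_boot all_order ssralg ssrnum ssrint.
From mathcomp Require Import boolp classical_sets.

Set Implicit Arguments.
Unset Strict Implicit.
Unset Printing Implicit Defensive.

Import Order.TTheory GRing.Theory Num.Theory.
Local Open Scope order_scope.
Local Open Scope group_scope.
Local Open Scope quotient_scope.

(** Let S be the successor map of the chain J x Z, (j, m) |-> (j, m + 1).  In a
chain with an invertible successor map, f^l^l is the conjugate S f S^-1, because
p < q means S p <= q ([lres_lres]).  Hence f is n-periodic exactly when it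
commutes with S^n ([nperiodic_resmapE]).  On J x Z this gives
f(j, m + n) = f(j, m) + n, so by monotonicity f maps each copy of Z into a single
copy of Z ([periodic_lexi]); this defines [base f] : J -> J.

The map [base] turns products into composites and meets into pointwise meets,
and, S being fibrewise, [base f^l^l = base f].  These three facts alone, recorded
as [lattice_action], imply that [base f^l] is a two-sided inverse of [base f]
([action_linvK], [action_linvKV]): f^l f <= 1 <= f f^l bounds the two composites
on one side, and the same inequalities for f^l bound them on the other.  So
[base f] is an automorphism of J, the components of f and of its residuals on the
fibres are adjoint to each other, and [base f] is the map that [is_tilde]
describes.  As the kernel of an action, the local subalgebra is convex and normal
([kernel_convex_normal]), and f and f^l^l are congruent modulo it.

For a convex normal H, normality and convexity pass to the trace of H on the
skeleton ([skeleton_convex_normal]), and the quotient by H is the quotient of the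
skeleton by this trace as soon as every congruence class meets the skeleton
([quo_skeleton]).  For n-periodic elements with f congruent to f^l^l, the class of
f contains the meet of the elements f, f^l^l, ..., f^(l^(2n-2)), which the map
x |-> x^l^l fixes because it permutes its factors; being fixed by this map means
lying in the skeleton ([skeleton_representative]). *)

(** * Subalgebras and residuated maps *)

Section Subalgebra.
Context d (A : lpregroupType d) (B : subalgebra A).
Implicit Types x y : B.

Lemma subalg_valM x y : val (x * y) = val x * val y. Proof. by []. Qed.
Lemma subalg_val1 : val (1 : B) = 1. Proof. by []. Qed.
Lemma subalg_valI x y : val (x `&` y) = val x `&` val y. Proof. by []. Qed.
Lemma subalg_valU x y : val (x `|` y) = val x `|` val y. Proof. by []. Qed.
Lemma subalg_valL x : val x^l = (val x)^l. Proof. by []. Qed.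
Lemma subalg_valR x : val x^r = (val x)^r. Proof. by []. Qed.

Lemma subalg_nperiodic n x : nperiodic n (val x) -> nperiodic n x.
Proof.
have iterL k : val (iter k linv x) = iter k linv (val x) by elim: k => //= k <-.
have iterR k : val (iter k rinv x) = iter k rinv (val x) by elim: k => //= k <-.
by rewrite /nperiodic /= -iterL -iterR => /val_inj.
Qed.

End Subalgebra.

Section ResiduatedMaps.
Context d (T : orderType d).
Implicit Types f g : resmap T.

Lemma resmap_mul f g p : val (f * g) p = val f (val g p). Proof. by []. Qed.
Lemma resmap_meet f g p : val (f `&` g) p = val f p `&` val g p.
Proof. by []. Qed.
Lemma resmap_linv f : val f^l = lres (val f). Proof. by []. Qed.
Lemma resmap_rinv f : val f^r = rres (val f). Proof. by []. Qed.

Lemma resmapP f : all_residuals (val f).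
Proof. exact: (set_mem (valP f)). Qed.

Lemma resmap_homo f : {homo val f : p q / p <= q}.
Proof.
have [fr _ _ _] := all_residuals_rl (resmapP f).
by move=> p q pq; rewrite fr (le_trans pq) // -fr.
Qed.

End ResiduatedMaps.

(** * The group skeleton and quotients *)

Section Skeleton.
Context d (A : lpregroupType d).
Implicit Types a b : A.

Lemma iter_rinvK n a : iter n linv (iter n rinv a) = a.
Proof. by elim: n => // n IHn; rewrite iterSr iterS rinvK. Qed.

Lemma iter_linvK n a : iter n rinv (iter n linv a) = a.
Proof. by elim: n => // n IHn; rewrite iterSr iterS linvK. Qed.

Lemma nperiodicE n a : nperiodic n a <-> iter (n + n) linv a = a.
Proof.
rewrite iterD /nperiodic /=; split=> [->|h]; first exact: iter_rinvK.
by rewrite -{2}h iter_linvK.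
Qed.

Variable H : set A.
Hypothesis cn : convex_normal_subalgebra H.
Let Hg : set (skeleton A) := [set g | H (val g)]%classic.

(** Normality of [H] only puts the truncation of a conjugate c at 1 in [H].
Applied to the inverse element it also gives the join of c and 1, and c lies
between the two truncations. *)
Lemma skeleton_convex_normal : convex_normal_lsubgroup Hg.
Proof.
have sH := cns_subalgebra cn; split.
- exact: subalg1 sH.
- by move=> a b Ha Hb; exact: (subalgM sH Ha Hb).
- by move=> a Ha; exact: (subalgL sH Ha).
- by move=> a b Ha Hb; exact: (subalgI sH Ha Hb).
- by move=> a b Ha Hb; exact: (subalgU sH Ha Hb).
- by move=> a b c Ha Hc ab bc; exact: (cns_convex cn Ha Hc ab bc).
move=> a b Ha.
have cut c : Hg c -> Hg ((c ^ b) `&` 1).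
  move=> Hc; rewrite /conjg mulgA -rinvE.
  by have [] := cns_normal cn (val b) Hc.
have lo := cut _ Ha.
have hi : Hg ((a ^ b) `|` 1).
  have -> : (a ^ b) `|` 1 = ((a^-1 ^ b) `&` 1)^l.
    by rewrite linvI linv1 linvE conjVg invgK.
  by apply: (subalgL sH); apply: cut; exact: (subalgL sH Ha).
exact: (cns_convex cn lo hi (leIl _ _) (leUl _ _)).
Qed.

(** Two elements of the skeleton are congruent in the skeleton precisely when
they are in [A], since the operations agree.  So the inclusion of the skeleton
induces an injective map of the quotients, which is onto when every class has a
representative in the skeleton; the isomorphism is its inverse. *)
Lemma quo_skeleton (cng : convex_normal_lsubgroup Hg) :
    (forall a, exists g : skeleton A, quo_rel H a (val g)) ->
  isomorphic (quo cn) (quo (convex_normal_lsubgroupW cng)).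
Proof.
move=> rep; set cng' := convex_normal_lsubgroupW cng.
have relE (g h : skeleton A) : quo_rel H (val g) (val h) = quo_rel Hg g h by [].
have repx (x : quo cn) : {g : skeleton A | \pi_(quo cn) (val g) = x}.
  apply: cid; elim/quotW: x => a; have [g ag] := rep a; exists g.
  by apply/quoP; rewrite quo_rel_sym.
pose f x := \pi_(quo cng') (projT1 (repx x)).
have fE (g : skeleton A) : f (\pi_(quo cn) (val g)) = \pi_(quo cng') g.
  rewrite /f; case: (repx _) => h /= /quoP; rewrite relE => hg.
  by apply/quoP.
have ind (P : quo cn -> Prop) :
    (forall g : skeleton A, P (\pi_(quo cn) (val g))) -> forall x, P x.
  by move=> Pg x; have [g <-] := repx x.
have fbij : bijective f.
  exists (fun y => \pi_(quo cn) (val (repr y))).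
    elim/ind => g; rewrite fE; apply/quoP; rewrite relE.
    by apply/quoP; rewrite reprK.
  by move=> y; rewrite fE reprK.
exists f; split=> //.
- elim/ind => g; elim/ind => h.
  by rewrite -[_ `&` _]pi_quo_meet -subalg_valI !fE pi_quo_meet.
- elim/ind => g; elim/ind => h.
  by rewrite -[_ `|` _]pi_quo_join -subalg_valU !fE pi_quo_join.
- elim/ind => g; elim/ind => h.
  by rewrite -[_ * _]pi_quo_mul -subalg_valM !fE pi_quo_mul.
- by rewrite -[LHS]/(f (\pi_(quo cn) (val (1 : skeleton A)))) fE.
- by elim/ind => g; rewrite -[_^l]pi_quo_linv -subalg_valL !fE pi_quo_linv.
- by elim/ind => g; rewrite -[_^r]pi_quo_rinv -subalg_valR !fE pi_quo_rinv.
Qed.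

Lemma le_linv2 a b : (a^l^l <= b^l^l) = (a <= b).
Proof. by rewrite !le_linv. Qed.

(** The meet of a, a^l^l, ..., a^(l^(2n-2)) is fixed by x |-> x^l^l, hence lies in
the skeleton, and it is congruent to a because each of its factors is. *)
Lemma skeleton_representative n :
    (0 < n)%N -> (forall a, nperiodic n a) -> (forall a, quo_rel H a a^l^l) ->
  forall a, exists g : skeleton A, quo_rel H a (val g).
Proof.
move=> n_gt0 per rel2 a.
pose x i := iter i (fun b : A => b^l^l) a.
pose m := fix m i := if i is i'.+1 then a `&` (m i')^l^l else a.
(* The recursion adds the factor a in front; equivalently, it adds the next
   iterate of a at the end. *)
have mS i : m i.+1 = m i `&` x i.+1.
  elim: i => [|i IHi] //.
  by rewrite -[LHS]/(a `&` (m i.+1)^l^l) {1}IHi linvI linvU meetA.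
have ma i : m i <= a by case: i => [|i]; [exact: lexx|exact: leIl].
have xE i : x i = iter (i + i) linv a by elim: i => //= i ->; rewrite addnS.
have xn : x n = a by rewrite xE; apply/nperiodicE.
have mrel i : quo_rel H a (m i).
  elim: i => [|i IHi]; first exact: quo_rel_refl.
  rewrite -{1}[a]meetxx; apply: (quo_relI cn) => //; first exact: quo_rel_refl.
  exact: (quo_rel_trans cn IHi (rel2 _)).
pose g := m n.-1.
have gll : g <= g^l^l.
  have {1}<- : m n.-1.+1 = g by rewrite mS prednK // xn; exact: meet_l (ma _).
  exact: leIr.
(* The ascending chain g <= g^l^l <= ... returns to g after n steps, so all its
   inequalities are equalities. *)
have gle i : g <= iter (i + i) linv g.
  elim: i => //= i IHi.
  by rewrite addnS (le_trans gll) // -!iterS !iterS le_linv2.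
have gE : g^l^l = g.
  apply/le_anti; rewrite gll andbT.
  have := gle n.-1; rewrite -le_linv2 -!iterS -addSn -addnS prednK //.
  by have /nperiodicE -> := per g.
have gs : g^l = g^r by rewrite -{2}gE linvK.
by exists (exist _ g (mem_set gs)); exact: mrel.
Qed.

End Skeleton.

(** * Actions on lattices *)

(** The last condition holds for every action by automorphisms in which both
residuals act as the inverse; conversely it forces the action to be of this kind. *)
Record lattice_action d (A : lpregroupType d) d' (J : latticeType d')
    (act : A -> J -> J) : Prop := {
  action1 : forall j, act 1 j = j;
  actionM : forall a b j, act (a * b) j = act a (act b j);
  actionI : forall a b j, act (a `&` b) j = act a j `&` act b j;
  action_linv2 : forall a j, act a^l^l j = act a j
}.

Lemma subalg_lattice_action d (A : lpregroupType d) (B : subalgebra A)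
    d' (J : latticeType d') (act : A -> J -> J) :
  lattice_action act -> lattice_action (fun x : B => act (val x)).
Proof.
move=> actP; split=> [j|x y j|x y j|x j].
- by rewrite subalg_val1 (action1 actP).
- by rewrite subalg_valM (actionM actP).
- by rewrite subalg_valI (actionI actP).
- by rewrite !subalg_valL (action_linv2 actP).
Qed.

Section Action.
Context d (A : lpregroupType d) d' (J : latticeType d') (act : A -> J -> J).
Hypothesis actP : lattice_action act.
Implicit Types a b : A.

Lemma action_le a b j : a <= b -> act a j <= act b j.
Proof. by move=> /meet_l ab; rewrite -{1}ab (actionI actP) leIr. Qed.

(** One inequality is a^l a <= 1, the other is 1 <= a^l a^l^l, where a^l^l acts
as a does. *)
Lemma action_linvK a : cancel (act a) (act a^l).
Proof.
move=> j; apply/le_anti/andP; split.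
  by rewrite -(actionM actP) -[leRHS](action1 actP) action_le ?mulVlp.
rewrite -(action_linv2 actP a) -(actionM actP) -[leLHS](action1 actP).
by rewrite action_le ?mulpVl.
Qed.

Lemma action_linvKV a : cancel (act a^l) (act a).
Proof. by move=> j; rewrite -(action_linv2 actP) action_linvK. Qed.

Lemma action_rinvK a : cancel (act a) (act a^r).
Proof. by have := action_linvKV a^r; rewrite rinvK. Qed.

Definition kernel : set A := [set a | act a = id]%classic.

Let kernelP a : kernel a <-> forall j, act a j = j.
Proof. by split=> [aE j|aE]; [rewrite aE|apply/funext]. Qed.

Let kernel1 : kernel 1. Proof. by apply/kernelP => j; rewrite (action1 actP). Qed.
Let kernelM a b : kernel a -> kernel b -> kernel (a * b).
Proof.
move=> /kernelP aE /kernelP bE; apply/kernelP => j.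
by rewrite (actionM actP) bE aE.
Qed.
Let kernelI a b : kernel a -> kernel b -> kernel (a `&` b).
Proof.
move=> /kernelP aE /kernelP bE; apply/kernelP => j.
by rewrite (actionI actP) bE aE meetxx.
Qed.
Let kernelL a : kernel a -> kernel a^l.
Proof.
by move=> /kernelP aE; apply/kernelP => j; rewrite -{1}[j]aE action_linvK.
Qed.
Let kernelR a : kernel a -> kernel a^r.
Proof.
by move=> /kernelP aE; apply/kernelP => j; rewrite -{1}[j]aE action_rinvK.
Qed.

Lemma kernel_convex_normal : convex_normal_subalgebra kernel.
Proof.
split.
- split=> // a b Ka Kb; rewrite -[a `|` b]linvK linvU.
  by apply/kernelR/kernelI; exact: kernelL.
- move=> a b c /kernelP aE /kernelP cE ab bc; apply/kernelP => j.
  apply/le_anti/andP; split; first by rewrite -[leRHS]cE action_le.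
  by rewrite -[leLHS]aE action_le.
move=> a b /kernelP aE; split; apply: kernelI => //; apply/kernelP => j.
  by rewrite !(actionM actP) aE action_rinvK.
by rewrite !(actionM actP) aE action_linvKV.
Qed.

Lemma quo_rel_kernel_linv2 a : quo_rel kernel a a^l^l.
Proof.
apply/asboolP; apply: kernelI => //; apply: kernelI; apply/kernelP => j.
  by rewrite (actionM actP) -(action_linv2 actP a) action_linvKV.
by rewrite (actionM actP) (action_linv2 actP) action_linvKV.
Qed.

End Action.

(** * Chains with an invertible successor map *)

Section Successor.
Context d (T : orderType d) (s p : T -> T).
Hypothesis sP : forall x y, (x < y) = (s x <= y).
Hypotheses (sK : cancel s p) (pK : cancel p s).

(** Negating the inequality of the adjunction between f^l and f exchanges the two
sides and makes both inequalities strict; the successor map turns them back into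
non-strict ones. *)
Lemma lres_lres (f : T -> T) : all_residuals f -> lres (lres f) = s \o f \o p.
Proof.
move=> /all_residuals_rl[_ lf _ _]; apply: adjoint_lres => x y /=.
by rewrite -sP ltNge -lf -ltNge sP pK.
Qed.

Lemma iter_linv2_resmap k (f : resmap T) x :
  val (iter (k + k) linv f) x = iter k s (val f (iter k p x)).
Proof.
elim: k x => // k IHk x.
rewrite addSn addnS 2![iter _.+1 linv f]iterS 2!resmap_linv lres_lres.
  by rewrite /= IHk -iterSr.
exact: resmapP.
Qed.

Lemma nperiodic_resmapE n (f : resmap T) :
  nperiodic n f <-> forall x, val f (iter n s x) = iter n s (val f x).
Proof.
have sKn : cancel (iter n s) (iter n p).
  by elim: (n) => // k IHk x; rewrite iterSr iterS sK.
have pKn : cancel (iter n p) (iter n s).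
  by elim: (n) => // k IHk x; rewrite iterSr iterS pK.
split=> [/nperiodicE fE x|fs]; first by rewrite -{1}fE iter_linv2_resmap sKn.
by apply/nperiodicE/val_inj/funext => x; rewrite iter_linv2_resmap -fs pKn.
Qed.

End Successor.

Lemma int_succP (x y : int) : (x < y) = (x + 1 <= y)%R.
Proof. by rewrite lezD1. Qed.

Lemma iter_int_succ k (m : int) : iter k (fun i => i + 1)%R m = (m + k%:Z)%R.
Proof.
by elim: k => [|k IHk]; rewrite ?addr0 // iterS IHk -addrA -PoszD addn1.
Qed.

(** * Periodic maps of a lexicographic product *)

Section Lexicographic.
Context d (J : orderType d).
Local Notation T := (J *l int).

Definition lexi_succ (x : T) : T := (x.1, (x.2 + 1)%R).
Definition lexi_pred (x : T) : T := (x.1, (x.2 - 1)%R).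

Lemma lexi_succP (x y : T) : (x < y) = (lexi_succ x <= y).
Proof. by rewrite ltEprodlexi leEprodlexi /= lezD1. Qed.

Lemma lexi_succK : cancel lexi_succ lexi_pred.
Proof. by case=> j m; rewrite /lexi_succ /lexi_pred /= addrK. Qed.

Lemma lexi_predK : cancel lexi_pred lexi_succ.
Proof. by case=> j m; rewrite /lexi_succ /lexi_pred /= subrK. Qed.

Lemma iter_lexi_succ k (x : T) : iter k lexi_succ x = (x.1, (x.2 + k%:Z)%R).
Proof.
elim: k => [|k IHk]; first by case: x => j m; rewrite /= addr0.
by rewrite iterS IHk /lexi_succ /= -addrA -PoszD addn1.
Qed.

Lemma le_lexi_fst (x y : T) : x <= y -> x.1 <= y.1.
Proof. by rewrite leEprodlexi => /andP[]. Qed.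

(** For periodic f, the base point 0 of the fibre can be replaced by any other
one, see [periodic_lexi]. *)
Definition base (f : resmap T) (j : J) : J := (val f (j, 0%R)).1.
Definition fibre (f : resmap T) (j : J) (m : int) : int := (val f (j, m)).2.

Variables (n : nat) (n_gt0 : (0 < n)%N).
Local Notation Fn := (periodic_resmap n T).

Lemma nperiodic_lexiE (f : resmap T) : nperiodic n f <-> forall j m,
  val f (j, (m + n%:Z)%R) = ((val f (j, m)).1, ((val f (j, m)).2 + n%:Z)%R).
Proof.
rewrite (nperiodic_resmapE lexi_succP lexi_succK lexi_predK).
split=> [h j m|h [j m]]; last by rewrite !iter_lexi_succ h.
by have := h (j, m); rewrite !iter_lexi_succ.
Qed.

(** The points (j, -nk) and (j, nk) have images over the same point of J as
(j, 0), by periodicity; for large k they enclose (j, m). *)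
Lemma periodic_lexi (f : resmap T) j m :
  nperiodic n f -> val f (j, m) = (base f j, fibre f j m).
Proof.
move=> /nperiodic_lexiE fn; rewrite /fibre [LHS]surjective_pairing; congr pair.
have shift k i : (val f (j, (i + (n * k)%N%:Z)%R)).1 = (val f (j, i)).1.
  elim: k => [|k IHk]; first by rewrite muln0 addr0.
  by rewrite mulnS addnC PoszD addrA fn /= IHk.
have le_nk : (`|m| <= (n * `|m|%N)%N%:Z)%R.
  by rewrite -abszE lez_nat leq_pmull.
have fst_le a b : (a <= b)%R -> (val f (j, a)).1 <= (val f (j, b)).1.
  by move=> ab; apply/le_lexi_fst/resmap_homo; rewrite lexi_pair lexx.
move: le_nk; rewrite ler_norml => /andP[lo hi]; apply/le_anti/andP; split.
  by rewrite /base -(shift `|m|%N 0%R); apply: fst_le; rewrite add0r.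
rewrite /base; have := shift `|m|%N (- (n * `|m|%N)%N%:Z)%R.
by rewrite addNr => ->; exact: fst_le.
Qed.

Lemma base_meet (f g : resmap T) j : base (f `&` g) j = base f j `&` base g j.
Proof.
rewrite /base resmap_meet [val f _ `&` _]meetEtotal.
case: (leP (val f _)) => [fg|/ltW gf]; first by rewrite meet_l // le_lexi_fst.
by rewrite meet_r // le_lexi_fst.
Qed.

Lemma base_homo (f : resmap T) : {homo base f : i j / i <= j}.
Proof.
move=> i j ij; apply/le_lexi_fst/resmap_homo; rewrite lexi_pair ij /=.
by apply/implyP.
Qed.

Lemma periodicP (f : Fn) : nperiodic n (val f).
Proof. exact: set_mem (valP f). Qed.

Lemma base_action : lattice_action (fun f : Fn => base (val f)).
Proof.
split=> [//|f g j|f g j|f j].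
- rewrite subalg_valM /base resmap_mul [val (val g) _]surjective_pairing.
  by rewrite periodic_lexi //; exact: periodicP.
- by rewrite subalg_valI base_meet.
- rewrite !subalg_valL /base !resmap_linv (lres_lres lexi_succP lexi_predK).
    by rewrite /= periodic_lexi //; exact: periodicP.
  exact: resmapP.
Qed.

Lemma base_automorphism (f : Fn) : order_automorphism (base (val f)).
Proof.
have bK := action_linvK base_action f; split.
  by exists (base (val f^l)); last exact: (action_linvKV base_action).
apply: le_mono => i j ij; rewrite lt_neqAle (base_homo (val f) (ltW ij)) andbT.
by rewrite (can_eq bK) (lt_eqF ij).
Qed.

(** The adjunctions between f and its residuals restrict to the fibres: f maps the
fibre over j to the fibre over [base f j], and its residuals map this fibre back. *)
Lemma fibre_residuals (f : Fn) j : all_residuals (fibre (val f) j).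
Proof.
apply: (@all_residuals_coind _ _ [set h | exists (f : Fn) j,
  h = fibre (val f) j]%classic); last by exists f, j.
move=> _ [{}f [{}j ->]].
have [fr lf _ _] := all_residuals_rl (resmapP (val f)).
have bl := action_linvK base_action f j.
have br := action_rinvK base_action f j.
have lexiE (g : Fn) i m := periodic_lexi i m (periodicP g).
exists (fibre (val f^r) (base (val f) j)), (fibre (val f^l) (base (val f) j)).
split.
- by exists f^r, (base (val f) j).
- by exists f^l, (base (val f) j).
- move=> p q; have := fr (j, p) (base (val f) j, q).
  by rewrite -resmap_rinv -subalg_valR !lexiE br !lexi_pair !lexx.
- move=> p q; have := lf (base (val f) j, p) (j, q).
  by rewrite -resmap_linv -subalg_valL !lexiE bl !lexi_pair !lexx.
Qed.

Definition fibre_resmap (f : Fn) j : resmap int :=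
  exist _ (fibre (val f) j) (mem_set (fibre_residuals f j)).

Lemma fibre_nperiodic (f : Fn) j : nperiodic n (fibre_resmap f j).
Proof.
apply/(nperiodic_resmapE int_succP (addrK 1%R) (subrK 1%R)) => m.
rewrite !iter_int_succ /= /fibre.
by have /nperiodic_lexiE -> := periodicP f.
Qed.

Lemma is_tildeE (f : Fn) t : is_tilde f t <-> base (val f) = t.
Proof.
have fb : is_tilde f (base (val f)).
  split; first exact: base_automorphism.
  exists (fun j => exist _ (fibre_resmap f j) (mem_set (fibre_nperiodic f j))
                   : periodic_resmap n int) => j m.
  exact: (periodic_lexi _ _ (periodicP f)).
by split=> [|<-//]; exact: is_tilde_unique fb.
Qed.

Lemma localE (L : subalgebra Fn) :
  local L = kernel (fun f : L => base (val (val f))).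
Proof. by apply/funext => f; apply/propext; exact: is_tildeE. Qed.

End Lexicographic.

Theorem lemma5p11 (n : nat) (d : Order.disp_t) (J : orderType d)
    (L : subalgebra (periodic_resmap n (J *l int))) :
  (0 < n)%N ->
  exists (loc_cn : convex_normal_subalgebra (local L))
         (locg_cn : convex_normal_lsubgroup (local_skeleton L)),
    isomorphic (quo loc_cn) (quo (convex_normal_lsubgroupW locg_cn)).
Proof.
move=> n_gt0; have actP := subalg_lattice_action L (base_action J n_gt0).
have cn : convex_normal_subalgebra (local L).
  by rewrite (localE n_gt0); exact: (kernel_convex_normal actP).
exists cn, (skeleton_convex_normal cn); apply: quo_skeleton.
apply: (skeleton_representative cn n_gt0) => f.
  by apply: subalg_nperiodic; apply: subalg_nperiodic; exact: periodicP.
by rewrite (localE n_gt0); exact: (quo_rel_kernel_linv2 actP).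
Qed.
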